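(* Let $a,b$ be integers such that $(a+b)(b-a-2)<0$, and let $(x_n)_{n\geq 0}$ be the third-order linear recurrence satisfying $$x_n=ax_{n-1}+bx_{n-2}+x_{n-3}$$ for all integers $n\geq 3$, with initial values $x_0=x_1=0$, $x_2=1$. If $p$ is a prime such that the characteristic polynomial $x^3-ax^2-bx-1$ of the recurrence is irreducible over $\mathbb{Q}_p$, then the quotient set $R((x_n)_{n\geq 0})$ is dense in $\mathbb{Q}_p$.
   Context: For a set of integers $A$, the quotient set (ratio set) of $A$ is $R(A)=\{a/b : a,b\in A,\ b\neq 0\}$; for a sequence $(x_n)_{n\ge 0}$ of integers, its quotient set $R((x_n)_{n\ge0})$ is $R(\{x_n : n\geq 0\})$. $\mathbb{Q}_p$ is the field of $p$-adic numbers, and denseness is with respect to the $p$-adic metric, with $R(A)\subset\mathbb{Q}\subset\mathbb{Q}_p$. *)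

(* Defs.v *)
From HB Require Import structures.
From mathcomp Require Import all_boot all_order all_algebra.
From mathcomp Require Import boolp classical_sets topology_structure
  uniform_structure pseudometric_structure metric_structure.

Set Implicit Arguments.
Unset Strict Implicit.
Unset Printing Implicit Defensive.

Import Order.TTheory GRing.Theory Num.Theory.
Local Open Scope ring_scope.
Local Open Scope classical_set_scope.

(** The ring of p-adic integers, as the inverse limit of the rings Z/p^n: the
    n-th term of the sequence is the canonical representative of the residue
    class modulo p^n.  Primality is carried by the type, so that its
    structures can be inferred. *)

Record ZZp (p : nat) (p_pr : prime p) := MkZZp {
  res : nat -> nat;
  res_coherent : forall n, res n = (res n.+1 %% p ^ n)%N }.

HB.instance Definition _ p p_pr := gen_eqMixin (@ZZp p p_pr).
HB.instance Definition _ p p_pr := gen_choiceMixin (@ZZp p p_pr).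

Section PadicIntegers.
Variables (p : nat) (p_pr : prime p).
Local Notation ZZp := (ZZp p_pr).
Implicit Types x y z : ZZp.

Lemma ppow_gt0 n : (0 < p ^ n)%N.
Proof. by rewrite expn_gt0 prime_gt0. Qed.

Lemma ZZp_ext x y : (forall n, res x n = res y n) -> x = y.
Proof.
case: x y => [f Hf] [g Hg] /= fg.
have {}fg : f = g by apply/funext.
by subst g; congr MkZZp; exact: Prop_irrelevance.
Qed.

Lemma res_lt x n : (res x n < p ^ n)%N.
Proof. by rewrite res_coherent ltn_mod ppow_gt0. Qed.

Lemma res_mod x m n : (m <= n)%N -> (res x n %% p ^ m)%N = res x m.
Proof.
move=> /subnKC <-; elim: (n - m)%N => [|k IH].
  by rewrite addn0 modn_small ?res_lt.
rewrite -[RHS]IH [in RHS]res_coherent modn_dvdm ?addnS //.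
by rewrite dvdn_exp2l // leq_addr.
Qed.

Definition reduce (f : nat -> nat) n := (f n %% p ^ n)%N.

Lemma reduce_coherent (f : nat -> nat) :
    (forall n, f n.+1 = f n %[mod p ^ n]) ->
  forall n, reduce f n = (reduce f n.+1 %% p ^ n)%N.
Proof. by move=> fE n; rewrite /reduce modn_dvdm ?fE // dvdn_exp2l. Qed.

Lemma res_eqmod x n : res x n.+1 = res x n %[mod p ^ n].
Proof. by rewrite res_mod // [RHS]modn_small ?res_lt. Qed.

Lemma ZZp_zero_proof n : ((fun=> 0) n.+1 = (fun=> 0) n %[mod p ^ n])%N.
Proof. by []. Qed.

Lemma ZZp_one_proof n : ((fun=> 1) n.+1 = (fun=> 1) n %[mod p ^ n])%N.
Proof. by []. Qed.

Lemma ZZp_add_proof x y n :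
  (res x n.+1 + res y n.+1 = res x n + res y n %[mod p ^ n])%N.
Proof. by rewrite -modnDm !res_eqmod modnDm. Qed.

Lemma ZZp_mul_proof x y n :
  (res x n.+1 * res y n.+1 = res x n * res y n %[mod p ^ n])%N.
Proof. by rewrite -modnMm !res_eqmod modnMm. Qed.

Lemma ZZp_opp_proof x n :
  (p ^ n.+1 - res x n.+1 = p ^ n - res x n %[mod p ^ n])%N.
Proof.
have lt0 := ltnW (res_lt x n); have lt1 := ltnW (res_lt x n.+1).
apply/eqP; rewrite -(eqn_modDr (res x n.+1)) subnK //.
rewrite -[X in _ == X]modnDmr res_eqmod modnDmr subnK // modnn.
by rewrite expnSr modnMr.
Qed.

Definition ZZp_zero : ZZp := MkZZp p_pr (reduce_coherent ZZp_zero_proof).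
Definition ZZp_one : ZZp := MkZZp p_pr (reduce_coherent ZZp_one_proof).
Definition ZZp_add x y : ZZp :=
  MkZZp p_pr (reduce_coherent (ZZp_add_proof x y)).
Definition ZZp_mul x y : ZZp :=
  MkZZp p_pr (reduce_coherent (ZZp_mul_proof x y)).
Definition ZZp_opp x : ZZp := MkZZp p_pr (reduce_coherent (ZZp_opp_proof x)).

Lemma ZZp_addA : associative ZZp_add.
Proof.
by move=> x y z; apply: ZZp_ext => n; rewrite /= /reduce modnDmr modnDml addnA.
Qed.

Lemma ZZp_addC : commutative ZZp_add.
Proof. by move=> x y; apply: ZZp_ext => n; rewrite /= /reduce addnC. Qed.

Lemma ZZp_add0 : left_id ZZp_zero ZZp_add.
Proof.
move=> x; apply: ZZp_ext => n; rewrite /= /reduce mod0n add0n.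
by rewrite modn_small ?res_lt.
Qed.

Lemma ZZp_addN : left_inverse ZZp_zero ZZp_opp ZZp_add.
Proof.
move=> x; apply: ZZp_ext => n; rewrite /= /reduce mod0n modnDml.
by rewrite subnK ?modnn // ltnW ?res_lt.
Qed.

HB.instance Definition _ :=
  GRing.isZmodule.Build ZZp ZZp_addA ZZp_addC ZZp_add0 ZZp_addN.

Lemma ZZp_mulA : associative ZZp_mul.
Proof.
by move=> x y z; apply: ZZp_ext => n; rewrite /= /reduce modnMmr modnMml mulnA.
Qed.

Lemma ZZp_mulC : commutative ZZp_mul.
Proof. by move=> x y; apply: ZZp_ext => n; rewrite /= /reduce mulnC. Qed.

Lemma ZZp_mul1 : left_id ZZp_one ZZp_mul.
Proof.
move=> x; apply: ZZp_ext => n; rewrite /= /reduce modnMml mul1n.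
by rewrite modn_small ?res_lt.
Qed.

Lemma ZZp_mulDl : left_distributive ZZp_mul ZZp_add.
Proof.
move=> x y z; apply: ZZp_ext => n.
by rewrite /= /reduce modnMml mulnDl modnDm.
Qed.

Lemma ZZp_one_neq0 : ZZp_one != 0.
Proof.
apply/eqP => /(congr1 (fun x => res x 1)); rewrite /= /reduce mod0n expn1.
by rewrite modn_small ?prime_gt1.
Qed.

HB.instance Definition _ := GRing.Zmodule_isComNzRing.Build ZZp
  ZZp_mulA ZZp_mulC ZZp_mul1 ZZp_mulDl ZZp_one_neq0.

Lemma res0 n : res (0 : ZZp) n = 0%N.
Proof. by rewrite /= /reduce mod0n. Qed.

Lemma resM x y n : res (x * y) n = (res x n * res y n %% p ^ n)%N.
Proof. by []. Qed.

Lemma resD x y n : res (x + y) n = ((res x n + res y n) %% p ^ n)%N.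
Proof. by []. Qed.

Lemma resN x n : res (- x) n = ((p ^ n - res x n) %% p ^ n)%N.
Proof. by []. Qed.

Lemma res_eq0_le x m n : (m <= n)%N -> res x n = 0%N -> res x m = 0%N.
Proof. by move=> mn xn; rewrite -(res_mod x mn) xn mod0n. Qed.

Lemma ZZp_neq0P x : x != 0 -> exists n, res x n.+1 != 0%N.
Proof.
move=> x0; apply: contrapT => xn; case/eqP: x0; apply: ZZp_ext => n.
rewrite res0; apply: (@res_eq0_le _ n n.+1) => //.
by apply/eqP; apply: contrapT => /negP xn0; apply: xn; exists n.
Qed.

(** The p-adic absolute value on Z_p: |x| = p^-v, where p^v is the largest
    power of p dividing x, and |0| = 0.  Its values are rational numbers. *)
Definition ZZp_norm x : rat :=
  match pselect (exists n, res x n.+1 != 0%N) with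
  | left nz => p%:R ^- ex_minn nz
  | right _ => 0
  end.

Lemma ZZp_norm0 : ZZp_norm 0 = 0.
Proof.
rewrite /ZZp_norm; case: pselect => // nz; exfalso.
by case: nz => n; rewrite res0.
Qed.

Lemma ZZp_normE x v :
  res x v = 0%N -> res x v.+1 != 0%N -> ZZp_norm x = p%:R ^- v.
Proof.
move=> xv xv1; rewrite /ZZp_norm; case: pselect => [nz|[]]; last by exists v.
congr (_ ^- _); case: ex_minnP => m xm1 min_m; apply/eqP.
rewrite eqn_leq min_m //= leqNgt; apply: contra xm1 => mv.
by apply/eqP; apply: res_eq0_le xv.
Qed.

Lemma ZZp_norm_spec x : x != 0 ->
  exists v, [/\ res x v = 0%N, res x v.+1 != 0%N & ZZp_norm x = p%:R ^- v].
Proof.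
move=> /ZZp_neq0P nz; case: (ex_minnP nz) => v xv1 min_v.
have xv : res x v = 0%N.
  case: v xv1 min_v => [|v] _ min_v.
    by apply/eqP; have := res_lt x 0; rewrite expn0 ltnS leqn0.
  apply/eqP; apply: contrapT => /negP /min_v; by rewrite ltnn.
by exists v; split => //; exact: ZZp_normE.
Qed.

Let pR_gt0 : 0 < p%:R :> rat.
Proof. by rewrite ltr0n prime_gt0. Qed.

Let pR_gt1 : 1 < p%:R :> rat.
Proof. by rewrite ltr1n prime_gt1. Qed.

Lemma ZZp_norm_gt0 x : x != 0 -> 0 < ZZp_norm x.
Proof. by case/ZZp_norm_spec => v [_ _ ->]; rewrite invr_gt0 exprn_gt0. Qed.

Lemma ZZp_norm_ge0 x : 0 <= ZZp_norm x.
Proof.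
by have [->|/ZZp_norm_gt0/ltW//] := eqVneq x 0; rewrite ZZp_norm0.
Qed.

Lemma ZZp_norm_le x n : ZZp_norm x <= p%:R ^- n <-> res x n = 0%N.
Proof.
have [->|/ZZp_norm_spec [v [xv xv1 ->]]] := eqVneq x 0.
  split=> _; first exact: res0.
  by rewrite ZZp_norm0 invr_ge0 exprn_ge0 // ltW.
rewrite lef_pV2 ?posrE ?exprn_gt0 // ler_eXn2l //; split=> [nv|xn].
  exact: res_eq0_le xv.
rewrite leqNgt; apply: contra xv1 => vn; apply/eqP.
exact: res_eq0_le xn.
Qed.

Lemma res_logn x v n : res x v = 0%N -> res x v.+1 != 0%N -> (v < n)%N ->
  (0 < res x n)%N /\ logn p (res x n) = v.
Proof.
move=> xv xv1 vn; have xn : (0 < res x n)%N.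
  rewrite lt0n; apply: contra xv1 => /eqP xn; apply/eqP.
  exact: res_eq0_le xn.
split=> //; apply/eqP; rewrite eqn_leq -pfactor_dvdn //.
rewrite /dvdn (res_mod _ (ltnW vn)) xv eqxx andbT leqNgt -pfactor_dvdn //.
by rewrite /dvdn res_mod.
Qed.

Lemma ZZp_normM x y : ZZp_norm (x * y) = ZZp_norm x * ZZp_norm y.
Proof.
have [->|/ZZp_norm_spec [v [xv xv1 ->]]] := eqVneq x 0.
  by rewrite mul0r ZZp_norm0 mul0r.
have [->|/ZZp_norm_spec [w [yw yw1 ->]]] := eqVneq y 0.
  by rewrite mulr0 ZZp_norm0 mulr0.
rewrite -invfM -exprD.
have vlt : (v < (v + w).+1)%N by rewrite ltnS leq_addr.
have wlt : (w < (v + w).+1)%N by rewrite ltnS leq_addl.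
have [x0 lx] := res_logn xv xv1 vlt; have [y0 ly] := res_logn yw yw1 wlt.
have lxy : logn p (res x (v + w).+1 * res y (v + w).+1) = (v + w)%N.
  by rewrite lognM // lx ly.
apply: ZZp_normE; last first.
  by rewrite resM -/(dvdn _ _) pfactor_dvdn ?muln_gt0 ?x0 // lxy ltnn.
rewrite -(res_mod (x * y) (leqnSn _)) resM modn_dvdm ?dvdn_exp2l //.
by apply/eqP; rewrite -/(dvdn _ _) pfactor_dvdn ?muln_gt0 ?x0 // lxy.
Qed.

Lemma ZZp_normD x y : ZZp_norm (x + y) <= Num.max (ZZp_norm x) (ZZp_norm y).
Proof.
wlog xy : x y / ZZp_norm x <= ZZp_norm y => [H|].
  case/orP: (le_total (ZZp_norm x) (ZZp_norm y)) => /H //.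
  by rewrite addrC maxC.
rewrite (max_idPr xy).
have [y0|y0] := eqVneq y 0; last first.
  have [v [yv _ yE]] := ZZp_norm_spec y0; move: xy; rewrite yE.
  by move=> /ZZp_norm_le xv; apply/ZZp_norm_le; rewrite resD xv yv mod0n.
by rewrite y0 addr0 -y0.
Qed.

Lemma ZZp_normN x : ZZp_norm (- x) = ZZp_norm x.
Proof.
have le z : ZZp_norm (- z) <= ZZp_norm z.
  have [->|z0] := eqVneq z 0; first by rewrite oppr0.
  have [v [zv _ ->]] := ZZp_norm_spec z0.
  by apply/ZZp_norm_le; rewrite resN zv subn0 modnn.
by apply/eqP; rewrite eq_le le -{1}[x]opprK le.
Qed.

Lemma ZZp_norm_eq0 x : (ZZp_norm x == 0) = (x == 0).
Proof.
have [->|/ZZp_norm_gt0/gt_eqF//] := eqVneq x 0; exact/eqP/ZZp_norm0.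
Qed.

(* Classical ring of units, needed to reach the integral domain structure. *)
Definition ZZp_unit : pred ZZp := fun x => `[< exists y, y * x = 1 >].

Definition ZZp_inv x : ZZp :=
  match pselect (exists y, y * x = 1) with
  | left ex => projT1 (cid ex)
  | right _ => x
  end.

Lemma ZZp_mulVx : {in ZZp_unit, left_inverse 1 ZZp_inv *%R}.
Proof.
move=> x /asboolP ex; rewrite /ZZp_inv; case: pselect => // ex'.
by case: (cid ex').
Qed.

Lemma ZZp_unitP x y : y * x = 1 -> ZZp_unit x.
Proof. by move=> yx; apply/asboolP; exists y. Qed.

Lemma ZZp_inv_out : {in [predC ZZp_unit], ZZp_inv =1 id}.
Proof.
move=> x /asboolP ex; rewrite /ZZp_inv; by case: pselect.
Qed.

HB.instance Definition _ :=
  GRing.ComNzRing_hasMulInverse.Build ZZp ZZp_mulVx ZZp_unitP ZZp_inv_out.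

Lemma ZZp_integral : GRing.integral_domain_axiom ZZp.
Proof.
by move=> x y xy; rewrite -!ZZp_norm_eq0 -mulf_eq0 -ZZp_normM xy ZZp_norm0.
Qed.

HB.instance Definition _ :=
  GRing.ComUnitRing_isIntegral.Build ZZp ZZp_integral.

End PadicIntegers.

Definition Qp (p : nat) (p_pr : prime p) : Type := {fraction ZZp p_pr}.

HB.instance Definition _ p p_pr := GRing.Field.on (@Qp p p_pr).

Local Notation "x %:F" := (@FracField.tofrac _ x).

Section PadicNumbers.
Variables (p : nat) (p_pr : prime p).
Local Notation ZZp := (ZZp p_pr).
Local Notation Qp := (Qp p_pr).

Definition ZZp_to_Qp : ZZp -> Qp := @FracField.tofrac ZZp.

HB.instance Definition _ := GRing.RMorphism.copy ZZp_to_Qp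
  (@FracField.tofrac ZZp : {rmorphism ZZp -> {fraction ZZp}}).

Lemma frac_numden (x : {fraction ZZp}) :
  x = (\n_(repr x))%:F / (\d_(repr x))%:F.
Proof.
rewrite -[LHS]reprK.
move: (repr x) => r.
apply: (mulIf (_ : (\d_r)%:F != 0)); first by rewrite tofrac_eq0 denom_ratioP.
rewrite divfK ?tofrac_eq0 ?denom_ratioP //.
unlock FracField.tofrac; rewrite -[LHS]FracField.pi_mul /FracField.mulf.
apply/eqmodP; rewrite /= FracField.equivfE.
by rewrite !numden_Ratio ?(mulr1, mulf_neq0, oner_neq0, denom_ratioP) // mulrC.
Qed.

(** The p-adic absolute value on Q_p, |n / d| = |n| / |d|. *)
Definition Qp_norm (x : Qp) : rat :=
  let r := repr (x : {fraction ZZp}) in ZZp_norm \n_r / ZZp_norm \d_r.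

Lemma ZZp_norm_neq0 (x : ZZp) : x != 0 -> ZZp_norm x != 0.
Proof. by rewrite ZZp_norm_eq0. Qed.

Lemma Qp_normE (n d : ZZp) : d != 0 ->
  Qp_norm (ZZp_to_Qp n / ZZp_to_Qp d) = ZZp_norm n / ZZp_norm d.
Proof.
move=> d0; set x : {fraction ZZp} := (_ / _).
have dF z : z != 0 -> ZZp_to_Qp z != 0 by rewrite tofrac_eq0.
set r := repr x; have rd0 : \d_r != 0 by apply: denom_ratioP.
have xE : x = ZZp_to_Qp \n_r / ZZp_to_Qp \d_r.
  exact: frac_numden.
have nr : n * \d_r = \n_r * d.
  apply/eqP; rewrite -tofrac_eq !tofracM -eqr_div ?tofrac_eq0 //.
  exact/eqP.
rewrite /Qp_norm -/x -/r; apply/eqP.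
by rewrite eqr_div ?ZZp_norm_neq0 // -!ZZp_normM nr.
Qed.

Lemma Qp_fracP (x : Qp) :
  exists n d : ZZp, d != 0 /\ x = ZZp_to_Qp n / ZZp_to_Qp d.
Proof.
exists \n_(repr x), \d_(repr x); split; first exact: denom_ratioP.
exact: frac_numden.
Qed.

Lemma Qp_norm0 : Qp_norm 0 = 0.
Proof.
have -> : 0 = ZZp_to_Qp 0 / ZZp_to_Qp 1 by rewrite rmorph0 mul0r.
by rewrite Qp_normE ?oner_neq0 // ZZp_norm0 mul0r.
Qed.

Lemma Qp_norm_eq0 (x : Qp) : (Qp_norm x == 0) = (x == 0).
Proof.
apply/eqP/eqP => [|->]; last exact: Qp_norm0.
have [n [d [d0 ->]]] := Qp_fracP x; rewrite Qp_normE // => /eqP.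
rewrite mulf_eq0 invr_eq0 !ZZp_norm_eq0 (negPf d0) orbF => /eqP ->.
by rewrite rmorph0 mul0r.
Qed.

Lemma Qp_norm_ge0 (x : Qp) : 0 <= Qp_norm x.
Proof.
have [n [d [d0 ->]]] := Qp_fracP x.
by rewrite Qp_normE // divr_ge0 ?ZZp_norm_ge0.
Qed.

Lemma Qp_normM (x y : Qp) : Qp_norm (x * y) = Qp_norm x * Qp_norm y.
Proof.
have [n [d [d0 ->]]] := Qp_fracP x; have [m [e [e0 ->]]] := Qp_fracP y.
by rewrite mulf_div -!rmorphM !Qp_normE ?mulf_neq0 // !ZZp_normM mulf_div.
Qed.

Lemma Qp_normN (x : Qp) : Qp_norm (- x) = Qp_norm x.
Proof.
have [n [d [d0 ->]]] := Qp_fracP x.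
by rewrite -mulNr -rmorphN !Qp_normE // ZZp_normN.
Qed.

Lemma Qp_normD (x y : Qp) : Qp_norm (x + y) <= Num.max (Qp_norm x) (Qp_norm y).
Proof.
have [n [d [d0 ->]]] := Qp_fracP x; have [m [e [e0 ->]]] := Qp_fracP y.
rewrite addf_div ?tofrac_eq0 // -!rmorphM -rmorphD !Qp_normE ?mulf_neq0 //.
have dV : 0 < (ZZp_norm (d * e))^-1 by rewrite invr_gt0 ZZp_norm_gt0 ?mulf_neq0.
have -> : ZZp_norm n / ZZp_norm d = ZZp_norm (n * e) / ZZp_norm (d * e).
  by rewrite !ZZp_normM -mulf_div divff ?mulr1 ?ZZp_norm_neq0.
have -> : ZZp_norm m / ZZp_norm e = ZZp_norm (m * d) / ZZp_norm (d * e).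
  rewrite !ZZp_normM [in RHS](mulrC (ZZp_norm d)).
  by rewrite -mulf_div divff ?mulr1 ?ZZp_norm_neq0.
by rewrite -maxr_pMl ?(ltW dV) // ler_pM2r // ZZp_normD.
Qed.

Definition Qp_dist (x y : Qp) : rat := Qp_norm (x - y).

Lemma Qp_distxx x : Qp_dist x x = 0.
Proof. by rewrite /Qp_dist subrr Qp_norm0. Qed.

Lemma Qp_dist_eq0 x y : Qp_dist x y = 0 -> x = y.
Proof. by move/eqP; rewrite Qp_norm_eq0 subr_eq0 => /eqP. Qed.

Lemma Qp_distC x y : Qp_dist x y = Qp_dist y x.
Proof. by rewrite /Qp_dist -opprB Qp_normN. Qed.

Lemma Qp_dist_triangle y x z : Qp_dist x z <= Qp_dist x y + Qp_dist y z.
Proof.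
have -> : Qp_dist x z = Qp_norm ((x - y) + (y - z)) by rewrite addrA subrK.
apply: le_trans (Qp_normD _ _) _.
by rewrite ge_max lerDl lerDr !Qp_norm_ge0.
Qed.

(* The p-adic distance takes rational values, so [rat] suffices as the ordered
   field of radii. *)
HB.instance Definition _ :=
  isMetric.Build rat Qp Qp_distxx Qp_dist_eq0 Qp_distC Qp_dist_triangle.

End PadicNumbers.

Definition quotient_set (A : set int) : set rat :=
  [set q | exists a b : int, [/\ A a, A b, b != 0 & q = a%:~R / b%:~R]].

(** The canonical embedding of Q into Q_p is [ratr]. *)
Definition dense_in_Qp (p : nat) (p_pr : prime p) (A : set rat) : Prop :=
  dense ((@ratr (Qp p_pr)) @` A).

(* Main.v *)
Require Import Defs.
From HB Require Import structures.
From mathcomp Require Import all_boot all_order all_algebra.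
From mathcomp Require Import boolp classical_sets topology_structure
  uniform_structure pseudometric_structure metric_structure.
From mathcomp Require Import ssrAC fingroup realalg ring lra zify.

Set Implicit Arguments.
Unset Strict Implicit.
Unset Printing Implicit Defensive.

Import Order.TTheory GRing.Theory Num.Theory.
Local Open Scope ring_scope.

(** Let C be the companion matrix of f = X^3 - aX^2 - bX - 1, so that x_n is the
    (0, 2) entry of C^n.  The hypothesis gives f(1) <> 0, while f has a positive
    real root; hence C has infinite order.  As C is invertible modulo p^2, some
    power C^N is 1 + p^e M with e >= 2 and p not dividing M, and then
    C^(N p^k) = 1 + p^g M_k with g = e + k and M_k = M modulo p.  Expanding,
    x_(N p^k n + i) = p^g (n w_i + p^g z) for i = 0, 1, where
    w_i = (M_k C^i)_(0, 2), since x_0 = x_1 = 0.  If p^2 divided both w_0 and w_1,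
    M_k would be scalar modulo p^2, and det C = 1 would force p | M_k; so one of
    the w_i has p-adic valuation at most 1, and the quotients of the
    corresponding terms approximate the quotients n / m, which are dense in Q_p. *)

(** * Powers of elements congruent to 1 *)

Lemma expr_1DMn (R : nzRingType) (M : R) q n :
  exists Z, (1 + M *+ q) ^+ n = 1 + M *+ (q * n) + Z *+ (q * q).
Proof.
elim: n => [|n [Z IH]].
  by exists 0; rewrite muln0 mulr0n mul0rn !addr0 expr0.
(* Collects the multiples of q^2 in (1 + qnM + q^2 Z)(1 + qM). *)
exists (M * M *+ n + Z + Z * M *+ q).
have -> : (M * M *+ n + Z + Z * M *+ q) *+ (q * q) =
    M *+ (q * n) * (M *+ q) + Z *+ (q * q) + Z *+ (q * q) * (M *+ q).
  rewrite !mulrnDl !mulrnAr !mulrnAl -!mulrnA.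
  by congr (_ *+ _ + _ + _ *+ _); lia.
rewrite exprSr IH mulrDr mulr1 !mulrDl mul1r mulnS mulrnDr -!addrA.
congr (_ + _); rewrite [RHS]addrCA; congr (_ + _).
by rewrite [LHS]addrCA; congr (_ + _); rewrite [LHS]addrCA.
Qed.

(** Each p-th power raises the exponent by one: the second-order remainder carries p^(2(e+k)), which
    e >= 2 makes a multiple of p^(e+k+2), so it only changes the coefficient of p^(e+k+1) by a
    multiple of p. *)
Lemma expr_ppow_1DMn (R : nzRingType) (M : R) p e k : (2 <= e)%N ->
  exists M', (1 + M *+ p ^ e) ^+ (p ^ k) = 1 + (M + M' *+ p) *+ p ^ (e + k).
Proof.
move=> e2; elim: k => [|k [M' IH]].
  by exists 0; rewrite mul0rn addn0 addr0 expr1.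
have [Z ZE] := expr_1DMn (M + M' *+ p) (p ^ (e + k)) p.
exists (M' + Z *+ p ^ (e + k - 2)).
rewrite expnSr exprM IH ZE addnS -expnSr -addrA; congr (_ + _).
rewrite (mulrnDl p M') addrA [RHS]mulrnDl; congr (_ + _).
rewrite -!mulrnA -!expnS -!expnD; congr (_ *+ _ ^ _); lia.
Qed.

(** * The companion matrix and its norm form *)

(** Row i holds the coordinates of c * c^i in the basis 1, c, c^2, where c is the class of X modulo
    f; hence the top row of u + sC + tC^2 is (u, s, t). *)
Definition companion3 (R : nzRingType) (a b : R) : 'M[R]_3 :=
  \matrix_(i, j) nth 0 (nth [::] [:: [:: 0; 1; 0]; [:: 0; 0; 1]; [:: 1; b; a]] i) j.

Lemma companion3_eq (R : comNzRingType) (a b : R) (C := companion3 a b) :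
  C ^+ 3 = a *: C ^+ 2 + b *: C + 1.
Proof.
apply/matrixP => i j; rewrite /C !exprS expr0 mulr1 -!mulmxE.
rewrite !(mxE, big_ord_recl, big_ord0) /=.
by case: i => [[|[|[|//]]]] ? /=; case: j => [[|[|[|//]]]] ? /=;
  rewrite /= ?mulr0n ?mulr1n; ring.
Qed.

(* The norm of u + s c + t c^2, where c is a root of X^3 - a X^2 - b X - 1. *)
Definition norm3 (R : nzRingType) (a b u s t : R) : R :=
  u ^+ 3
  + s * (a * u ^+ 2 - b * s * u - (a * b + 3) * t * u + s ^+ 2 + a * s * t - b * t ^+ 2)
  + t * ((a ^+ 2 + 2 * b) * u ^+ 2 + (b ^+ 2 - 2 * a) * t * u + t ^+ 2).

(** Reducing t C^3 by the characteristic equation gives the next coordinates, and the norm is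
    unchanged because c has norm 1. This is det C^n = 1 read on coordinates. *)
Lemma companion3_expP (R : comNzRingType) (a b : R) (C := companion3 a b) n :
  exists u s t : R, C ^+ n = u%:M + s *: C + t *: C ^+ 2 /\ norm3 a b u s t = 1.
Proof.
elim: n => [|n [u [s [t [CE <-]]]]].
  exists 1, 0, 0; rewrite !scale0r !addr0 expr0; split=> //.
  by rewrite /norm3; ring.
exists t, (u + b * t), (s + a * t); split; last by rewrite /norm3; ring.
rewrite exprSr CE -(scalemx1 _ u) -(scalemx1 _ t) !mulrDl -!scalerAl mul1r.
rewrite -expr2 -exprSr companion3_eq.
rewrite !scalerDl !scalerDr !scalerA [b * t]mulrC [a * t]mulrC.
by rewrite !addrA [LHS](ACl (5*1*4*2*3)%AC).
Qed.

Lemma companion3_comb_row0 (R : nzRingType) (a b u s t : R) (C := companion3 a b)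
    (M := u%:M + s *: C + t *: C ^+ 2) :
  [/\ M 0 0 = u, M 0 1 = s & M 0 2 = t].
Proof.
rewrite /M /C expr2 -mulmxE; split;
  rewrite !(mxE, big_ord_recl, big_ord0) /= ?mulr1n ?mulr0n;
  by rewrite !(mulr0, mulr1, mul0r, mul1r, addr0, add0r).
Qed.

Lemma companion3_exp_rec (R : comNzRingType) (a b : R) (C := companion3 a b) (x : nat -> R) :
  x 0%N = 0 -> x 1%N = 0 -> x 2 = 1 ->
  (forall n, x n.+3 = a * x n.+2 + b * x n.+1 + x n) ->
  forall n, (C ^+ n) 0 2 = x n.
Proof.
move=> x0 x1 x2 xS n.
suff [] : [/\ (C ^+ n) 0 2 = x n, (C ^+ n.+1) 0 2 = x n.+1 & (C ^+ n.+2) 0 2 = x n.+2] by [].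
elim: n => [|n [IH0 IH1 IH2]].
  rewrite x0 x1 x2 expr0 expr1 expr2 -mulmxE /C.
  rewrite !(mxE, big_ord_recl, big_ord0) /= ?mulr1n ?mulr0n.
  by rewrite !(mulr0, mulr1, mul0r, mul1r, addr0, add0r).
split=> //; rewrite xS -IH2 -IH1 -IH0.
have -> : C ^+ n.+3 = a *: C ^+ n.+2 + b *: C ^+ n.+1 + C ^+ n.
  rewrite -(addn3 n) exprD companion3_eq !mulrDr mulr1 -!scalerAr.
  by rewrite -exprD -exprSr addn2.
by rewrite !mxE.
Qed.

(** In the expansion of the norm minus 1, all terms but 3qr are multiples of q p^2; hence p^2
    divides 3r. *)
Lemma norm3_eq1_dvdz p (a b r s t Q : int) : prime p -> Q != 0 ->
  let q := p%:Z ^+ 2 * Q in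
  norm3 a b (1 + q * r) (q * (p%:Z ^+ 2 * s)) (q * (p%:Z ^+ 2 * t)) = 1 ->
  (p %| r)%Z.
Proof.
move=> p_pr Q0 q; set P := p%:Z in q *.
have P0 : P != 0 by rewrite /P; case: (p) p_pr.
set u := 1 + q * r; set s' := q * _; set t' := q * (_ * t) => nE.
have : q * (3 * r + P ^+ 2 * (3 * Q * r ^+ 2 + P ^+ 2 * Q ^+ 2 * r ^+ 3
  + s * (a * u ^+ 2 - b * s' * u - (a * b + 3) * t' * u + s' ^+ 2 + a * s' * t' - b * t' ^+ 2)
  + t * ((a ^+ 2 + 2 * b) * u ^+ 2 + (b ^+ 2 - 2 * a) * t' * u + t' ^+ 2))) = 0.
  by rewrite -[RHS](subrr 1) -[X in _ = X - 1]nE /norm3 /u /s' /t' /q; ring.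
set K := (X in P ^+ 2 * X).
move/eqP; rewrite !mulf_eq0 (negPf Q0) (negPf P0) /= addr_eq0 => /eqP rE.
have : (P ^+ 2 %| 3 * r)%Z by rewrite rE rpredN dvdz_mulr.
(* At p = 3 the factor 3 absorbs one power of p, and the square still leaves 3 | r. *)
have [p3|p3] := eqVneq p 3%N.
  by rewrite /P p3 expr2 dvdz_mul2l.
move=> /(dvdz_trans (dvdz_exp2l P (isT : 1 <= 2)%N)).
rewrite expr1 !dvdzE abszM Euclid_dvdM // (dvdn_prime2 _ (isT : prime 3)) //.
by rewrite (negPf p3).
Qed.

(** * Infinite order over Z, finite order modulo q *)

(** C has a nonnegative real eigenvalue r; C^N = 1 would give r^N = 1, so r = 1, whereas f(1) = -(a
    + b). *)
Lemma companion3_inf_order (a b : int) N : (0 < N)%N -> a + b != 0 ->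
  companion3 a b ^+ N != 1.
Proof.
move=> N0 ab; apply/eqP => CN.
pose R : rcfType := realalg.
pose A : R := a%:~R; pose B : R := b%:~R.
pose f : {poly R} := 'X^3 - A *: 'X^2 - B *: 'X - 1.
have fE r : f.[r] = r ^+ 3 - A * r ^+ 2 - B * r - 1.
  by rewrite /f !hornerE.
(* Chosen so that c^3 = 2c^2 + |A|c^2 + |B|c^2 dominates the other terms of f(c). *)
pose c : R := 2 + `|A| + `|B|.
have c0 : 0 <= c by rewrite /c !addr_ge0.
have fc : f.[0] <= 0 <= f.[c].
  rewrite !fE; apply/andP; split; first by rewrite !expr0n /= !mulr0 !subr0 sub0r oppr_le0.
  have := ler_norm A; have := ler_norm B; have := normr_ge0 A; have := normr_ge0 B.
  rewrite /c; move: `|A| `|B| => A' B' B'0 A'0 BB' AA'.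
  have cP : 0 <= 2 + A' + B' by lra.
  have : 0 <= (A' - A) * (2 + A' + B') ^+ 2 by rewrite mulr_ge0 ?exprn_ge0 ?subr_ge0.
  have : 0 <= (B' - B) * (2 + A' + B') by rewrite mulr_ge0 ?subr_ge0.
  nra.
have [r /andP[r0 _] /eqP] := poly_ivt c0 fc; rewrite fE => fr.
pose v : 'cV[R]_3 := \col_i r ^+ i.
pose D := companion3 A B.
have Dv : D *m v = r *: v.
  apply/colP => i; rewrite !(mxE, big_ord_recl, big_ord0) /=.
  case: i => [[|[|[|//]]]] ? /=; try ring.
  by move: fr; rewrite /= => fr; lra.
have DN : D ^+ N = 1.
  rewrite -(rmorph1 (map_mx intr : 'M[int]_3 -> 'M[R]_3)) -CN rmorphXn /=.
  congr (_ ^+ _); apply/matrixP => i j; rewrite !mxE.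
  by case: i => [[|[|[|//]]]] ?; case: j => [[|[|[|//]]]] ?.
have Dnv n : D ^+ n *m v = r ^+ n *: v.
  elim: n => [|n IH]; first by rewrite !expr0 mul1mx scale1r.
  by rewrite !exprS -mulmxE -mulmxA IH -scalemxAr Dv scalerA mulrC.
have := Dnv N; rewrite DN mul1mx => /matrixP/(_ 0 0).
rewrite !mxE expr0 mulr1 => /esym/eqP; rewrite pexpr_eq1 // => /eqP r1.
move: fr; rewrite r1 !expr1n !mulr1 => fr.
case/eqP: ab; apply: (@intr_inj R); rewrite rmorphD /= -/A -/B; lra.
Qed.

Lemma intr_Zp_eq0 q (z : int) : (1 < q)%N -> (z%:~R == 0 :> 'Z_q) = (q %| z)%Z.
Proof.
move=> q1; have nE n : (n%:R == 0 :> 'Z_q) = (q %| n)%N.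
  by rewrite -val_eqE /= val_Zp_nat.
by case: z => n; rewrite dvdzE /= ?NegzE ?mulrNz ?oppr_eq0 nE.
Qed.

Lemma mulrn_mxP m n (E : 'M[int]_(m, n)) (q : nat) :
  (exists M, E = M *+ q) <-> (forall i j, (q %| E i j)%Z).
Proof.
split=> [[M ->] i j|qE]; first by rewrite mulmxnE -mulr_natr natz dvdz_mull.
exists (\matrix_(i, j) (E i j %/ q)%Z); apply/matrixP => i j.
by rewrite mulmxnE mxE -mulr_natr natz divzK.
Qed.

(** The characteristic equation exhibits an inverse of C over Z, so C reduces to a unit of the
    finite ring of matrices over Z/q; N is its order there. *)
Lemma companion3_order_mod (a b : int) q : (1 < q)%N ->
  exists2 N, (0 < N)%N & exists M, companion3 a b ^+ N = 1 + M *+ q.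
Proof.
move=> q1; set C := companion3 a b.
pose A : 'M['Z_q]_3 := map_mx intr C.
have CV : C * (C ^+ 2 - a *: C - b *: 1) = 1.
  rewrite !mulrBr -!scalerAr mulr1 -expr2 -exprS companion3_eq.
  by rewrite -addrA -opprD addrC addKr.
have AU : A \is a GRing.unit.
  rewrite unitmxE -unitmxE.
  have [] // := @mulmx1_unit _ _ A (map_mx intr (C ^+ 2 - a *: C - b *: 1)).
  by rewrite -map_mxM mulmxE CV map_mx1.
pose g : {unit 'M['Z_q]_3} := FinRing.unit _ AU.
exists #[g]%g; first exact: order_gt0.
suff [M ME] : exists M, C ^+ #[g]%g - 1 = M *+ q.
  by exists M; rewrite -ME addrC subrK.
apply/mulrn_mxP => i j; rewrite -intr_Zp_eq0 //; apply/eqP.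
have : map_mx intr (C ^+ #[g]%g - 1) = 0 :> 'M['Z_q]_3.
  rewrite map_mxB rmorphXn /= map_mx1 -/A.
  by rewrite -(FinRing.val_unitX _ g) expg_order subrr.
by move/matrixP/(_ i j); rewrite !mxE.
Qed.

(** * Exact powers of p along the orbit *)

(** The valuation of a nonzero entry bounds the exponents, so a largest one exists. *)
Lemma mulrn_mx_maxn m n (E : 'M[int]_(m, n)) p e0 : prime p -> E != 0 ->
  (exists M, E = M *+ p ^ e0) ->
  exists e M, [/\ (e0 <= e)%N, E = M *+ p ^ e & ~ exists M', M = M' *+ p].
Proof.
move=> p_pr /matrix0Pn [i0 [j0 E0]] /mulrn_mxP pE0.
pose P e := [forall i, forall j, (p ^ e %| `|E i j|)%N].
have PP e : reflect (exists M, E = M *+ p ^ e) (P e).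
  apply: (iffP idP) => [/forallP PE|/mulrn_mxP PE].
    by apply/mulrn_mxP => i j; move/forallP: (PE i) => /(_ j).
  by apply/forallP => i; apply/forallP => j; exact: PE.
have P0 : exists e, P e by exists e0; apply/PP/mulrn_mxP.
have Pbound e : P e -> (e <= logn p `|E i0 j0|)%N.
  by move=> /forallP/(_ i0)/forallP/(_ j0); rewrite pfactor_dvdn // absz_gt0.
case: (ex_maxnP P0 Pbound) => e /PP [M EM] emax.
exists e, M; split=> //; first by apply: emax; apply/PP/mulrn_mxP.
case=> M' MM'; suff /emax : P e.+1 by rewrite ltnn.
by apply/PP; exists M'; rewrite EM MM' -mulrnA expnS.
Qed.

Lemma PoszX n k : (n ^ k)%N%:Z = n%:Z ^+ k.
Proof. by rewrite -!natz natrX. Qed.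

(** The entries for i = 0, 1 are M02 and M01 + a M02. If p^2 divided both, the coordinates of C^N on
    C and C^2 would be multiples of p^(g+2), norm 1 would force p | M00, and M = M00 + M01 C + M02
    C^2 would be a multiple of p. *)
Lemma companion3_ppow_ndvd (a b : int) p N g (M : 'M[int]_3) (C := companion3 a b) :
  prime p -> (2 <= g)%N -> C ^+ N = 1 + M *+ p ^ g -> (~ exists M', M = M' *+ p) ->
  exists2 i, (i < 2)%N & ~~ ((p ^ 2)%N %| (M * C ^+ i)%R 0%R 2%R)%Z.
Proof.
move=> p_pr g2 CN pM; pose w i := (M * C ^+ i) 0 2.
have w0 : w 0%N = M 0 2 by rewrite /w expr0 mulr1.
have w1 : w 1%N = M 0 1 + a * M 0 2.
  rewrite /w expr1 -mulmxE !(mxE, big_ord_recl, big_ord0) /= mulr0 mulr1 addr0 add0r mulrC.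
  by congr (M _ _ + _ * M _ _); apply/val_inj.
have [|p2w0] := boolP ((p ^ 2)%N %| w 0%N)%Z; last by exists 0%N.
rewrite w0 => p2t; exists 1%N => //; rewrite -/(w 1%N) w1; apply/negP => p2w1.
have p2s : ((p ^ 2)%N %| M 0%R 1%R)%Z.
  by rewrite -(rpredDr (M 0 1) (_ : a * M 0 2 \in dvdz (p ^ 2)%N)) ?dvdz_mull.
have [u [s [t [CE nE]]]] := companion3_expP a b N.
have [] := companion3_comb_row0 a b u s t; rewrite -CE CN => r0 r1 r2.
have {r0 r1 r2} [uE sE tE] : [/\ u = 1 + p%:Z ^+ g * M 0 0, s = p%:Z ^+ g * M 0 1
    & t = p%:Z ^+ g * M 0 2].
  by rewrite -r0 -r1 -r2 !mxE !mulmxnE /= mulr1n !add0r -!(mulr_natl (M _ _)) !natz !PoszX.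
have gE : p%:Z ^+ g = p%:Z ^+ 2 * p%:Z ^+ (g - 2) by rewrite -exprD subnKC.
have p0 : p%:Z != 0 by case: (p) p_pr.
have pg0 : p%:Z ^+ g != 0 by rewrite expf_neq0.
have pr : (p %| M 0%R 0%R)%Z.
  have [s' s'E] := dvdzP p2s; have [t' t'E] := dvdzP p2t.
  apply: (@norm3_eq1_dvdz p a b (M 0 0) s' t' (p%:Z ^+ (g - 2))) => //.
    by rewrite expf_neq0.
  by move: nE; rewrite uE sE tE s'E t'E PoszX /= -gE ![_ * p%:Z ^+ 2]mulrC.
have pp2 : (p %| Posz (p ^ 2))%Z by rewrite dvdzE /= dvdn_exp.
apply: pM; apply/mulrn_mxP => i j.
have toN z : p%:Z ^+ g * z = z *+ p ^ g by rewrite -PoszX -mulr_natl natz.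
have : M *+ p ^ g = (M 0 0 *: 1 + M 0 1 *: C + M 0 2 *: C ^+ 2) *+ p ^ g.
  apply: (addrI 1); rewrite -CN CE uE sE tE !toN.
  by rewrite !mulrnDl !scalerMnl scalemx1 !raddfD !raddfMn /= !addrA.
move/matrixP/(_ i j); rewrite !mulmxnE -!toN => /(mulfI pg0) ->.
rewrite !mxE !rpredD // dvdz_mulr //; exact: (dvdz_trans pp2).
Qed.

(** In quotients of such entries p^g cancels, leaving n w up to a multiple of p^g. The bound on the
    valuation of w does not depend on K, so the error becomes negligible against w. *)
Lemma companion3_orbit (a b : int) p K (C := companion3 a b) :
  prime p -> a + b != 0 ->
  exists g (w : int), [/\ (K <= g)%N, ~~ ((p ^ 2)%N %| w)%Z &
    forall n, exists m (z : int), (C ^+ m) 0 2 = p%:Z ^+ g * (n%:Z * w + p%:Z ^+ g * z)].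
Proof.
move=> p_pr ab; have p1 := prime_gt1 p_pr.
have p21 : (1 < p ^ 2)%N by rewrite -(exp1n 2) ltn_exp2r.
have [N N0 [M0 M0E]] := companion3_order_mod a b p21.
have E0 : C ^+ N - 1 != 0 by rewrite subr_eq0 companion3_inf_order.
have [|e [M [e2 EM pM]]] := mulrn_mx_maxn p_pr E0 (e0 := 2).
  by exists M0; rewrite M0E addrC addKr.
have {EM} CN : C ^+ N = 1 + M *+ p ^ e by rewrite -EM addrC subrK.
have [M' M'E] := expr_ppow_1DMn M p K e2.
have pM' : ~ exists M1, M + M' *+ p = M1 *+ p.
  by case=> M1 M1E; apply: pM; exists (M1 - M'); rewrite mulrnBl -M1E addrK.
have {}CN : C ^+ (N * p ^ K) = 1 + (M + M' *+ p) *+ p ^ (e + K).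
  by rewrite exprM CN M'E.
move: (M + M' *+ p) pM' CN => {M'E M' pM} {}M pM CN.
have [|i i2 wi] := companion3_ppow_ndvd p_pr _ CN pM; first by rewrite (leq_trans e2) ?leq_addr.
exists (e + K)%N, ((M * C ^+ i) 0 2); split=> //; first exact: leq_addl.
move=> n; have [Z ZE] := expr_1DMn M (p ^ (e + K)) n.
exists (N * p ^ K * n + i)%N, ((Z * C ^+ i) 0 2).
(* As x_0 = x_1 = 0, the term 1 of the expansion contributes nothing and p^g factors out. *)
have Ci : (C ^+ i) 0 2 = 0.
  by case: i i2 {wi} => [|[|]] // _; rewrite ?expr0 ?expr1 !mxE.
rewrite exprD exprM CN ZE !mulrDl mul1r !mulrnAl.
move: (M * C ^+ i) (Z * C ^+ i) => MC ZC.
rewrite [LHS]mxE [X in X + _]mxE Ci add0r !mulmxnE.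
rewrite -(mulr_natr (MC 0 2)) -(mulr_natr (ZC 0 2)) !natz !PoszM PoszX; ring.
Qed.

(** * Approximation in Q_p *)

(** [ratr] uses the reduced fraction; cross-multiplication passes to any other one once nonzero
    integers stay nonzero in [F]. *)
Lemma ratr_div (F : fieldType) (a b : int) :
  (forall z : int, z != 0 -> z%:~R != 0 :> F) -> b != 0 ->
  ratr (a%:~R / b%:~R) = a%:~R / b%:~R :> F.
Proof.
move=> F0 b0; set q : rat := _ / _.
have : (numq q)%:~R / (denq q)%:~R == a%:~R / b%:~R :> rat by rewrite divq_num_den.
rewrite eqr_div ?intr_eq0 ?denq_neq0 // -!rmorphM /= eqr_int => /eqP qE.
by apply/eqP; rewrite /ratr eqr_div ?F0 ?denq_neq0 // -!rmorphM /= qE.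
Qed.

(** The terms x y w cancel, so the difference is small when a is close to x w and b to y w, with the
    denominator bounded below. *)
Lemma subr_div_mod (F : fieldType) (x y a b w : F) : y != 0 -> b != 0 ->
  x / y - a / b = (x * (b - y * w) - y * (a - x * w)) / (y * b).
Proof. by move=> y0 b0; field; rewrite y0 b0. Qed.

Section PadicApproximation.
Variables (p : nat) (p_pr : prime p).
Local Notation ZZp := (ZZp p_pr).
Local Notation Qp := (Qp p_pr).
Local Notation toQp := (@ZZp_to_Qp p p_pr).

Let pR_gt0 : 0 < p%:R :> rat.
Proof. by rewrite ltr0n prime_gt0. Qed.

Let pR_gt1 : 1 < p%:R :> rat.
Proof. by rewrite ltr1n prime_gt1. Qed.

Lemma res_nat n k : res (n%:R : ZZp) k = (n %% p ^ k)%N.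
Proof.
elim: n => [|n IH]; first by rewrite res0 mod0n.
by rewrite -addn1 natrD resD IH /= /reduce modnDml modnDmr.
Qed.

Lemma res_natK (x : ZZp) k : ZZp_norm ((res x k)%:R - x) <= p%:R ^- k.
Proof.
apply/ZZp_norm_le; rewrite resD resN res_nat modnDm.
by rewrite subnKC ?modnn // ltnW // res_lt.
Qed.

Lemma Qp_norm_toQp (x : ZZp) : Qp_norm (toQp x) = ZZp_norm x.
Proof.
have norm1 : ZZp_norm (1 : ZZp) = 1.
  rewrite (@ZZp_normE _ _ _ 0) ?expr0 ?invr1 //.
  by rewrite -[1]/(1%:R) res_nat expn1 modn_small ?prime_gt1.
by rewrite -[toQp x]divr1 -(rmorph1 toQp) Qp_normE ?oner_neq0 // norm1 divr1.
Qed.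

Lemma ZZp_norm_le1 (x : ZZp) : ZZp_norm x <= 1.
Proof.
rewrite -[X in _ <= X]invr1 -(expr0 p%:R); apply/ZZp_norm_le.
by apply/eqP; have := res_lt x 0; rewrite expn0 ltnS leqn0.
Qed.

Lemma Qp_norm_int_le (z : int) k :
  Qp_norm (z%:~R : Qp) <= p%:R ^- k <-> ((p ^ k)%N %| z)%Z.
Proof.
have nE n : Qp_norm (n%:R : Qp) <= p%:R ^- k <-> (p ^ k %| n)%N.
  rewrite -(rmorph_nat toQp) Qp_norm_toQp; rewrite ZZp_norm_le res_nat /dvdn.
  by split=> /eqP.
by rewrite dvdzE; case: z => n; rewrite ?NegzE ?mulrNz ?Qp_normN nE.
Qed.

Lemma Qp_norm_int_le1 (z : int) : Qp_norm (z%:~R : Qp) <= 1.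
Proof.
have [_] := Qp_norm_int_le z 0; rewrite !expr0 invr1; apply.
by rewrite dvdzE dvd1n.
Qed.

Lemma intr_Qp_neq0 (z : int) : z != 0 -> z%:~R != 0 :> Qp.
Proof.
move=> z0; apply/eqP => zE.
(* Every power of p would divide z, yet p^|z| exceeds |z|. *)
have : ((p ^ `|z|)%N %| z)%Z.
  by apply/Qp_norm_int_le; rewrite zE Qp_norm0 invr_ge0 exprn_ge0 // ltW.
rewrite dvdzE => /dvdn_leq; rewrite absz_gt0 => /(_ z0).
by rewrite leqNgt ltn_expl ?prime_gt1.
Qed.

Lemma exists_ppow_lt (t : rat) : 0 < t -> exists k, p%:R ^- k < t.
Proof.
move=> t0; exists (Num.bound t^-1).
rewrite -[ltRHS]invrK ltf_pV2 ?posrE ?invr_gt0 ?exprn_gt0 //.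
apply: (lt_le_trans (archi_boundP _)); first by rewrite invr_ge0 ltW.
by rewrite -natrX ler_nat; apply/ltnW/ltn_expl/prime_gt1.
Qed.

(** For a target nu / de with nu, de in Z_p, taking n to be their residues modulo p^g gives elements
    of S that, stripped of p^g, are close to nu w and de w; then w cancels in the quotient. *)
Lemma dense_quotient_set (S : set int) :
  (forall K, exists g (w : int), [/\ (K <= g)%N, ~~ ((p ^ 2)%N %| w)%Z &
    forall n : nat, exists z : int, S (p%:Z ^+ g * (n%:Z * w + p%:Z ^+ g * z))]) ->
  dense_in_Qp p_pr (quotient_set S).
Proof.
move=> HS O [y Oy] oO.
have /nbhs_ballP [eps /= eps0 epsO] : nbhs y O by apply: open_nbhs_nbhs.
have [nu [de [de0 yE]]] := Qp_fracP y.
have dn0 : 0 < ZZp_norm de by rewrite ZZp_norm_gt0.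
have P2 : 0 < p%:R ^- 2 :> rat by rewrite invr_gt0 exprn_gt0.
(* The first bound keeps |b| at least |de| p^-2; the second makes the error smaller than eps times
   the resulting lower bound for |de b|. *)
have [K] := @exists_ppow_lt (Num.min (ZZp_norm de * p%:R ^- 2)
    (eps * (ZZp_norm de * (ZZp_norm de * p%:R ^- 2)))) ltac:(by rewrite lt_min !mulr_gt0).
rewrite lt_min => /andP[K1 K2].
have [g [w [Kg pw Sg]]] := HS K.
have gK : p%:R ^- g <= p%:R ^- K :> rat.
  by rewrite lef_pV2 ?posrE ?exprn_gt0 // ler_eXn2l.
have g0 := le_lt_trans gK K1; have g1 := le_lt_trans gK K2.
have wn : p%:R ^- 2 <= Qp_norm (w%:~R : Qp).
  by rewrite ltW // ltNge; apply: contra pw => /Qp_norm_int_le.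
have approx (x : ZZp) : exists a : int, S (p%:Z ^+ g * a) /\
    Qp_norm (a%:~R - toQp x * w%:~R) <= p%:R ^- g.
  have [z Sz] := Sg (res x g); exists ((res x g)%:Z * w + p%:Z ^+ g * z); split=> //.
  rewrite rmorphD !rmorphM /= addrAC -mulrBl; apply: le_trans (Qp_normD _ _) _.
  rewrite ge_max -rmorphM /= -PoszX; apply/andP; split; last first.
    by apply/Qp_norm_int_le; rewrite dvdz_mulr.
  have -> : (res x g)%:~R - toQp x = toQp ((res x g)%:R - x).
    by rewrite rmorphB /= rmorph_nat.
  rewrite Qp_normM Qp_norm_toQp -[X in _ <= X]mulr1.
  by rewrite ler_pM ?ZZp_norm_ge0 ?Qp_norm_ge0 ?res_natK ?Qp_norm_int_le1.
have [a [Sa aE]] := approx nu; have [b [Sb bE]] := approx de.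
have dw : ZZp_norm de * p%:R ^- 2 <= Qp_norm (toQp de * w%:~R).
  by rewrite Qp_normM Qp_norm_toQp ler_pM2l.
(* Ultrametric inequality: b differs from de w by less than the lower bound for |de w|. *)
have bn : ZZp_norm de * p%:R ^- 2 <= Qp_norm (b%:~R : Qp).
  have : Qp_norm (toQp de * w%:~R) <=
      Num.max (Qp_norm (b%:~R : Qp)) (Qp_norm (- (b%:~R - toQp de * w%:~R))).
    by rewrite (le_trans _ (Qp_normD _ _)) // subKr.
  rewrite le_max Qp_normN => /orP[|/le_trans/(_ bE)]; first exact: le_trans.
  by rewrite leNgt (lt_le_trans g0 dw).
have bQ0 : b%:~R != 0 :> Qp.
  by rewrite -Qp_norm_eq0 gt_eqF // (lt_le_trans _ bn) // mulr_gt0.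
have b0 : b != 0 by apply: contraNneq bQ0 => ->; rewrite mulr0z.
have pg0 : p%:Z ^+ g != 0 by rewrite expf_neq0 // eqz_nat -lt0n prime_gt0.
exists (a%:~R / b%:~R); split; last first.
  exists ((p%:Z ^+ g * a)%:~R / (p%:Z ^+ g * b)%:~R).
    by exists (p%:Z ^+ g * a), (p%:Z ^+ g * b); rewrite mulf_neq0.
  rewrite ratr_div ?mulf_neq0 //; last exact: intr_Qp_neq0.
  by rewrite !rmorphM /= -mulf_div divff ?mul1r // intr_Qp_neq0.
apply: epsO; rewrite ballEmdist /= -[mdist _ _]/(Qp_dist _ _) /Qp_dist.
have deQ0 : toQp de != 0 by rewrite -Qp_norm_eq0 Qp_norm_toQp gt_eqF.
have -> : y - a%:~R / b%:~R = (toQp nu * (b%:~R - toQp de * w%:~R)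
    - toQp de * (a%:~R - toQp nu * w%:~R)) / (toQp de * b%:~R).
  by rewrite yE; exact: subr_div_mod.
set c := (X in X / _); have cn : Qp_norm c <= p%:R ^- g.
  rewrite (le_trans (Qp_normD _ _)) // Qp_normN ge_max !Qp_normM !Qp_norm_toQp.
  by apply/andP; split; rewrite -[leRHS]mul1r ler_pM ?ZZp_norm_ge0 ?Qp_norm_ge0 ?ZZp_norm_le1.
have dbn : ZZp_norm de * (ZZp_norm de * p%:R ^- 2) <= Qp_norm (toQp de * b%:~R).
  by rewrite Qp_normM Qp_norm_toQp ler_pM2l.
rewrite -(ltr_pM2r (lt_le_trans _ dbn)) ?mulr_gt0 // -Qp_normM divfK ?mulf_neq0 //.
by rewrite (le_lt_trans cn) // (lt_le_trans g1) // ler_pM2l.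
Qed.

End PadicApproximation.

Theorem corollary1p4 (a b : int) (hab : (a + b) * (b - a - 2) < 0)
  (x : nat -> int)
  (hrec : forall n : nat, (3 <= n)%N ->
    x n = a * x (n - 1)%N + b * x (n - 2)%N + x (n - 3)%N)
  (h0 : x 0%N = 0) (h1 : x 1%N = 0) (h2 : x 2%N = 1)
  (p : nat) (p_pr : prime p)
  (hirr : irreducible_poly
    ('X^3 - a%:~R *: 'X^2 - b%:~R *: 'X - 1 : {poly Qp p_pr})) :
  dense_in_Qp p_pr (quotient_set (range x)).
Proof.
(* This is f(1) <> 0. *)
have ab : a + b != 0 by apply: contraTneq hab => ->; rewrite mul0r ltxx.
have xS n : x n.+3 = a * x n.+2 + b * x n.+1 + x n.
  by rewrite hrec // !subSS !subn0.
have xE := companion3_exp_rec h0 h1 h2 xS.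
apply: dense_quotient_set => K.
have [g [w [Kg pw wE]]] := companion3_orbit K p_pr ab.
exists g, w; split=> // n; have [m [z mE]] := wE n.
by exists z; exists m; rewrite // -xE mE.
Qed.
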